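(* Within the pseudovariety $\mathsf M$ of all finite monoids, each of the sets of pseudoidentities $\Sigma=\{x^{\omega+1}=x^\omega,\ (xy)^\omega(yx)^\omega(xy)^\omega=(xy)^\omega\}$ and $\Gamma=\{((xy)^\omega x)^2=(xy)^\omega x\}$ is h-strong.
   Context: $\mathsf M$ is the pseudovariety of finite monoids (signature: multiplication and $1$); $\Omega_A\mathsf M$ is the free profinite monoid on a finite set $A$. In a profinite monoid $x^\omega=\lim x^{n!}$ and $x^{\omega+1}=x^\omega x$. An $\mathsf M$-pseudoidentity is $u=v$ with $u,v\in\Omega_B\mathsf M$, $B$ finite; it holds in a finite monoid $T$ if both sides agree under every continuous homomorphism $\Omega_B\mathsf M\to T$; $[\![\Sigma]\!]$ is the class of finite monoids satisfying $\Sigma$. Provability: for finite $A$, $\Sigma_0\subseteq\Omega_A\mathsf M\times\Omega_A\mathsf M$ is the set of pairs $(\mathbf t(\varphi(u),w_1,\dots,w_n),\mathbf t(\varphi(v),w_1,\dots,w_n))$ with $u=v$ or $v=u$ in $\Sigma$ ($u,v\in\Omega_B\mathsf M$), $\varphi:\Omega_B\mathsf M\to\Omega_A\mathsf M$ a continuous homomorphism, $\mathbf t$ a monoid term, $w_i\in\Omega_A\mathsf M$; $\Sigma_{2\alpha+1}$ is the transitive closure of $\Sigma_{2\alpha}$, $\Sigma_{2\alpha+2}$ the topological closure of $\Sigma_{2\alpha+1}$, unions at limit ordinals; $u=v$ is provable from $\Sigma$ if $(u,v)\in\bigcup_\alpha\Sigma_\alpha$. A set $\Sigma$ is h-strong within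 $\mathsf M$ if every $\mathsf M$-pseudoidentity valid in $[\![\Sigma]\!]$ is provable from $\Sigma$. *)

(* Defs.v *)
From mathcomp Require Import all_boot.
Set Implicit Arguments. Unset Strict Implicit. Unset Printing Implicit Defensive.

Record finMonoid := FinMonoid {
  fm_car :> finType;
  fm_mul : fm_car -> fm_car -> fm_car;
  fm_one : fm_car;
  fm_mulA : forall x y z, fm_mul x (fm_mul y z) = fm_mul (fm_mul x y) z;
  fm_mul1 : forall x, fm_mul fm_one x = x;
  fm_mul1r : forall x, fm_mul x fm_one = x }.

Arguments fm_mul {_}.
Arguments fm_one {_}.

Definition fm_hom (S T : finMonoid) (h : S -> T) : Prop :=
  h fm_one = fm_one /\ forall x y, h (fm_mul x y) = fm_mul (h x) (h y).

Fixpoint fm_exp (T : finMonoid) (t : T) (n : nat) : T :=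
  if n is n'.+1 then fm_mul t (fm_exp t n') else fm_one.

(* t^omega in a finite monoid T: the limit of t^(n!), which is reached
   (and constant) from n = |T| on. *)
Definition fm_omega (T : finMonoid) (t : T) : T := fm_exp t (#|T|)`!.

(* The free profinite monoid Omega_A M, realized as the monoid of A-ary      *)
(* implicit operations on finite monoids (Reiterman): an element u assigns   *)
(* to every finite monoid T and every assignment e : A -> T a value u T e,   *)
(* naturally with respect to all monoid homomorphisms.                        *)
Definition impl (A : finType) := forall T : finMonoid, (A -> T) -> T.

Definition inOmega (A : finType) (u : impl A) : Prop :=
  forall (S T : finMonoid) (h : S -> T), fm_hom h ->
    forall e : A -> S, h (u S e) = u T (fun a => h (e a)).

Definition om_var (A : finType) (a : A) : impl A := fun T e => e a.
Definition om_one (A : finType) : impl A := fun T e => fm_one.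
Definition om_mul (A : finType) (u v : impl A) : impl A :=
  fun T e => fm_mul (u T e) (v T e).
Definition om_omega (A : finType) (u : impl A) : impl A :=
  fun T e => fm_omega (u T e).
Definition om_omega1 (A : finType) (u : impl A) : impl A :=
  om_mul (om_omega u) u.

(* The profinite topology of Omega_A M is the initial topology of the
   evaluation maps u |-> u T e into the (discrete) finite monoids T.
   (Finite intersections of basic open sets are again basic, by taking
   products of finite monoids, so the sets {v | v T e = u T e} form a
   neighbourhood basis of u.) *)

Definition cont_hom (B A : finType) (phi : impl B -> impl A) : Prop :=
  (forall u, inOmega u -> inOmega (phi u)) /\
  phi (@om_one B) = @om_one A /\
  (forall u v, inOmega u -> inOmega v -> phi (om_mul u v) = om_mul (phi u) (phi v)) /\
  (* continuity: the preimage of every basic neighbourhood of phi u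
     contains a basic neighbourhood of u *)
  (forall u, inOmega u -> forall (T : finMonoid) (e : A -> T),
     exists (T' : finMonoid) (e' : B -> T'),
       forall v, inOmega v -> v T' e' = u T' e' -> phi v T e = phi u T e).

Record pseudoid := Pseudoid {
  pi_alph : finType;
  pi_lhs : impl pi_alph;
  pi_rhs : impl pi_alph }.
Arguments pi_lhs : clear implicits.
Arguments pi_rhs : clear implicits.
Arguments om_one : clear implicits.

(* u = v holds in T : both sides agree under every continuous homomorphism
   Omega_B M -> T, i.e. under evaluation at every assignment e : B -> T. *)
Definition holds_in (T : finMonoid) (B : finType) (u v : impl B) : Prop :=
  forall e : B -> T, u T e = v T e.

Definition models (Sig : pseudoid -> Prop) (T : finMonoid) : Prop :=
  forall p, Sig p -> holds_in T (pi_lhs p) (pi_rhs p).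

(* monoid terms; variable 0 is the distinguished slot, variable i.+1 is w_i *)
Inductive mterm := MVar of nat | MOne | MMul of mterm & mterm.

Fixpoint mterm_eval (A : finType) (t : mterm) (x : impl A) (ws : seq (impl A))
  : impl A :=
  match t with
  | MVar 0 => x
  | MVar i.+1 => nth (@om_one A) ws i
  | MOne => @om_one A
  | MMul t1 t2 => om_mul (mterm_eval t1 x ws) (mterm_eval t2 x ws)
  end.

Definition Sigma0 (Sig : pseudoid -> Prop) (A : finType) (s r : impl A) : Prop :=
  exists (p : pseudoid) (phi : impl (pi_alph p) -> impl A)
         (t : mterm) (ws : seq (impl A)),
    Sig p /\ cont_hom phi /\ (forall i, inOmega (nth (om_one A) ws i)) /\
    ((s = mterm_eval t (phi (pi_lhs p)) ws /\ r = mterm_eval t (phi (pi_rhs p)) ws) \/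
     (s = mterm_eval t (phi (pi_rhs p)) ws /\ r = mterm_eval t (phi (pi_lhs p)) ws)).

(* The union over all ordinals alpha of the sets Sigma_alpha is the least
   subset of Omega_A M x Omega_A M containing Sigma_0 and closed under
   transitive closure and topological closure; we define it inductively. *)
Inductive provable (Sig : pseudoid -> Prop) (A : finType) : impl A -> impl A -> Prop :=
  | prov_base : forall s r, Sigma0 Sig s r -> provable Sig s r
  | prov_trans : forall s r q, provable Sig s r -> provable Sig r q -> provable Sig s q
  | prov_closure : forall s r, inOmega s -> inOmega r ->
      (* every basic neighbourhood of (s, r) in Omega_A M x Omega_A M
         meets the relation *)
      (forall (T : finMonoid) (e : A -> T),
         exists s' r', provable Sig s' r' /\ s' T e = s T e /\ r' T e = r T e) ->
      provable Sig s r.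

Definition h_strong (Sig : pseudoid -> Prop) : Prop :=
  forall (B : finType) (u v : impl B), inOmega u -> inOmega v ->
    (forall T : finMonoid, models Sig T -> holds_in T u v) ->
    provable Sig u v.

Definition lx1 : 'I_1 := @Ordinal 1 0 isT.
Definition lx : 'I_2 := @Ordinal 2 0 isT.
Definition ly : 'I_2 := @Ordinal 2 1 isT.

Definition pid_aper : pseudoid :=
  @Pseudoid 'I_1 (om_omega1 (om_var lx1)) (om_omega (om_var lx1)).

Definition pid_DS : pseudoid :=
  let xy := om_mul (om_var lx) (om_var ly) in
  let yx := om_mul (om_var ly) (om_var lx) in
  @Pseudoid 'I_2
    (om_mul (om_mul (om_omega xy) (om_omega yx)) (om_omega xy))
    (om_omega xy).

Definition pid_Gamma : pseudoid :=
  let w := om_mul (om_omega (om_mul (om_var lx) (om_var ly))) (om_var lx) in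
  @Pseudoid 'I_2 (om_mul w w) w.

Definition SigmaSet (p : pseudoid) : Prop := p = pid_aper \/ p = pid_DS.
Definition GammaSet (p : pseudoid) : Prop := p = pid_Gamma.

(* Main.v *)
(* Both bases define the pseudovariety DA, and the basis Gamma proves Sigma. Provability
   is a closed congruence on the free profinite monoid Omega, and the closure rule reduces
   an identity [u = v] valid in DA to the following task: given a finite monoid [T] and an
   assignment [e] of the letters in [T], find provably equal members of Omega whose values
   in [T] are those of [u] and [v].
   Replace [u], [v] by words [x], [y] with the same values in [T] and in the quotient of
   the free monoid by the congruence [sim n], defined by recursively splitting words at
   first and last occurrences of letters. These quotients lie in DA, so [sim n x y].
   Now peel from the left of [x] and [y], at the first occurrence of the letter that comes
   last, and then symmetrically from the right. If the remainder loses a letter after few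
   steps on either side, induction on the alphabet applies. Otherwise a pigeonhole argument
   in [T * T] exhibits on each side a factor of full content that may be replaced by its
   omega power, and the bases prove [w^omega g v^omega = w^omega v^omega] whenever [w] and
   [v] contain all the letters of [g]. *)
From Stdlib Require Import Setoid Morphisms.
Require Import Defs.
From mathcomp Require Import all_boot.
From mathcomp Require Import boolp.
Set Implicit Arguments. Unset Strict Implicit. Unset Printing Implicit Defensive.

(** * Omega powers in finite monoids *)

Declare Scope fm_scope.
Delimit Scope fm_scope with M.
Local Infix "*" := fm_mul : fm_scope.

Section FiniteMonoid.
Local Open Scope fm_scope.
Variable T : finMonoid.
Implicit Types s t : T.

Lemma fm_expD t m n : fm_exp t (m + n) = fm_exp t m * fm_exp t n.
Proof. by elim: m => [|m IH] /=; rewrite ?fm_mul1 // IH fm_mulA. Qed.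

Lemma fm_expSr t n : fm_exp t n.+1 = fm_exp t n * t.
Proof. by rewrite -addn1 fm_expD /= fm_mul1r. Qed.

Lemma fm_expM t m n : fm_exp t (m * n)%N = fm_exp (fm_exp t m) n.
Proof. by elim: n => [|n IH]; rewrite ?muln0 // mulnS fm_expD IH. Qed.

Lemma fm_exp_idem t n : t * t = t -> fm_exp t n.+1 = t.
Proof. by move=> tt; elim: n => [|n IH] /=; [rewrite fm_mul1r | rewrite -/(fm_exp t n.+1) IH]. Qed.

Lemma fm_exp_swap s t n : s * fm_exp (t * s) n = fm_exp (s * t) n * s.
Proof.
elim: n => [|n IH]; first by rewrite /= fm_mul1 fm_mul1r.
by rewrite /= -!fm_mulA IH !fm_mulA.
Qed.

Lemma fm_exp_period t i p m : fm_exp t (i + p) = fm_exp t i -> i <= m ->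
  forall k, fm_exp t (m + k * p)%N = fm_exp t m.
Proof.
move=> per im; elim=> [|k IH]; first by rewrite addn0.
rewrite -(subnKC im) mulSnr addnA in IH *.
by rewrite fm_expD IH -fm_expD addnAC fm_expD per -fm_expD.
Qed.

(** Among the powers of [t] with exponents from 0 to [#|T|] two coincide. Their distance is at most
    [#|T|], so it divides the factorial of [#|T|], and that exponent already lies in the periodic
    range. *)
Lemma fm_omega_idem t : fm_omega t * fm_omega t = fm_omega t.
Proof.
pose f (i : 'I_#|T|.+1) := fm_exp t i.
have /injectivePn [i [j ij fij]] : ~~ injectiveb f.
  by apply/injectiveP => /leq_card; rewrite card_ord ltnn.
wlog {ij} lt_ij : i j fij / i < j.
  by move=> W; case: (ltngtP i j) => [/W|/W|/val_inj/eqP]; [exact| exact |rewrite (negPf ij)].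
have le_jT : j <= #|T| by rewrite -ltnS.
have [k defM] : exists k, #|T|`! = (k * (j - i))%N.
  by apply/dvdnP/dvdn_fact; rewrite subn_gt0 lt_ij (leq_trans (leq_subr _ _)).
rewrite /fm_omega -fm_expD {2}defM (@fm_exp_period t i) //.
  by rewrite subnKC ?(ltnW lt_ij).
by rewrite (leq_trans (ltnW lt_ij)) // (leq_trans le_jT) // fact_geq.
Qed.

Lemma fm_idem_power_uniq t m n : 0 < m -> 0 < n ->
  fm_exp t m * fm_exp t m = fm_exp t m -> fm_exp t n * fm_exp t n = fm_exp t n ->
  fm_exp t m = fm_exp t n.
Proof.
case: m => [|m]; case: n => [|n] // _ _ idm idn.
by rewrite -(fm_exp_idem n idm) -(fm_exp_idem m idn) -!fm_expM mulnC.
Qed.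

Lemma fm_omega_swap s t : s * fm_omega (t * s) = fm_omega (s * t) * s.
Proof. exact: fm_exp_swap. Qed.

Lemma fm_omega_comm t : t * fm_omega t = fm_omega t * t.
Proof. by rewrite /fm_omega -fm_expSr. Qed.

Lemma fm_omegaM t : fm_omega (fm_omega t * t) = fm_omega t.
Proof.
have omE (u : T) : fm_omega u = fm_exp u (#|T|`!).-1.+1 by rewrite prednK ?fact_gt0.
rewrite {2}/fm_omega -fm_expSr omE -fm_expM mulnC fm_expM -omE.
exact: fm_exp_idem (fm_omega_idem t).
Qed.

End FiniteMonoid.

(** The exponents defining the two omega powers depend on [S] and on [T], but both sides are
    idempotent powers of [h t] with positive exponents, and such powers coincide. *)
Lemma fm_hom_omega (S T : finMonoid) (h : S -> T) t :
  fm_hom h -> h (fm_omega t) = fm_omega (h t).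
Proof.
case=> h1 hM; have hX n : h (fm_exp t n) = fm_exp (h t) n.
  by elim: n => //= n IH; rewrite hM IH.
rewrite hX; apply: fm_idem_power_uniq; rewrite ?fact_gt0 //; last exact: fm_omega_idem.
by rewrite -hX -hM fm_omega_idem.
Qed.

(** * Free profinite monoids and provability *)

Definition Omega (A : finType) := {u : impl A | inOmega u}.

Section Omega.
Variable A : finType.
Implicit Types u v w : Omega A.

Lemma OmegaP u v : (forall T e, sval u T e = sval v T e) -> u = v.
Proof.
case: u v => [u uO] [v vO] /= uv; apply: eq_exist => /=.
by apply: functional_extensionality_dep => T; apply: funext.
Qed.

Lemma Omega_natural u (S T : finMonoid) (h : S -> T) (e : A -> S) :
  fm_hom h -> h (sval u S e) = sval u T (fun a => h (e a)).
Proof. by move=> hh; apply: (svalP u). Qed.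

Lemma inOmega_var (a : A) : inOmega (om_var a).
Proof. by []. Qed.

Lemma inOmega_one : inOmega (om_one A).
Proof. by move=> S T h []. Qed.

Lemma inOmega_mul u v : inOmega (om_mul (sval u) (sval v)).
Proof. by move=> S T h hh e; rewrite /om_mul (proj2 hh) !(Omega_natural _ _ hh). Qed.

Lemma inOmega_omega u : inOmega (om_omega (sval u)).
Proof. by move=> S T h hh e; rewrite /om_omega (fm_hom_omega _ hh) (Omega_natural _ _ hh). Qed.

Definition Ovar a : Omega A := exist _ _ (inOmega_var a).
Definition Oone : Omega A := exist _ _ inOmega_one.
Definition Omul u v : Omega A := exist _ _ (inOmega_mul u v).
Definition Oomega u : Omega A := exist _ _ (inOmega_omega u).

End Omega.

Arguments Oone {A}.
Local Infix "**" := Omul (at level 40, left associativity).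

Section OmegaTheory.
Variable A : finType.
Implicit Types u v w x y : Omega A.

Lemma OmulA u v w : u ** (v ** w) = u ** v ** w.
Proof. by apply: OmegaP => T e; apply: fm_mulA. Qed.

Lemma Omul1 u : Oone ** u = u.
Proof. by apply: OmegaP => T e; apply: fm_mul1. Qed.

Lemma Omulr1 u : u ** Oone = u.
Proof. by apply: OmegaP => T e; apply: fm_mul1r. Qed.

Fixpoint Oexp u n := if n is n'.+1 then u ** Oexp u n' else Oone.

Lemma OexpE u n T e : sval (Oexp u n) T e = fm_exp (sval u T e) n.
Proof. by elim: n => //= n IH; rewrite /om_mul IH. Qed.

Lemma Oomega_idem u : Oomega u ** Oomega u = Oomega u.
Proof. by apply: OmegaP => T e; apply: fm_omega_idem. Qed.

Lemma Oomega_comm u : u ** Oomega u = Oomega u ** u.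
Proof. by apply: OmegaP => T e; apply: fm_omega_comm. Qed.

Lemma Oomega_swap x y : x ** Oomega (y ** x) = Oomega (x ** y) ** x.
Proof. by apply: OmegaP => T e; apply: fm_omega_swap. Qed.

Lemma Oomega_omegaM u : Oomega (Oomega u ** u) = Oomega u.
Proof. by apply: OmegaP => T e; apply: fm_omegaM. Qed.

Fixpoint Oword (w : seq A) := if w is a :: w' then Ovar a ** Oword w' else Oone.

Lemma Oword_cat (w1 w2 : seq A) : Oword (w1 ++ w2) = Oword w1 ** Oword w2.
Proof. by elim: w1 => [|a w IH] /=; rewrite ?Omul1 // IH OmulA. Qed.

End OmegaTheory.

(** The homomorphism that sends the generators to [z]. Its value at [(T, e)] reads [u] at a single
    assignment in [T], which is what makes it continuous. *)
Definition subst_impl (B A : finType) (z : B -> Omega A) (u : impl B) : impl A :=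
  fun T e => u T (fun b => sval (z b) T e).

Lemma cont_hom_subst (B A : finType) (z : B -> Omega A) : cont_hom (subst_impl z).
Proof.
split=> [u uO S T h hh e|]; last split=> //; last split=> // u uO T e.
  rewrite /subst_impl uO //; congr (u T _).
  by apply: funext => b; rewrite (Omega_natural _ _ hh).
by exists T, (fun b => sval (z b) T e).
Qed.

(** The distinguished slot stays at index 0 while the parameters move up by one, freeing index 1 for
    a new multiplier. *)
Fixpoint mterm_shift (t : mterm) : mterm :=
  match t with
  | MVar 0 => MVar 0
  | MVar i.+1 => MVar i.+2
  | MOne => MOne
  | MMul t1 t2 => MMul (mterm_shift t1) (mterm_shift t2)
  end.

Lemma mterm_eval_shift (A : finType) t (x w : impl A) ws :
  mterm_eval (mterm_shift t) x (w :: ws) = mterm_eval t x ws.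
Proof. by elim: t => [[|i]||t1 IH1 t2 IH2] //=; rewrite IH1 IH2. Qed.

(* The induction principle generated for [provable] gives no hypothesis for the
   derivations nested under the existential quantifier of [prov_closure]. *)
Lemma provable_nested_ind (S : pseudoid -> Prop) (A : finType) (P : impl A -> impl A -> Prop) :
  (forall s r, Sigma0 S s r -> P s r) ->
  (forall s r q, P s r -> P r q -> P s q) ->
  (forall s r, inOmega s -> inOmega r ->
     (forall (T : finMonoid) (e : A -> T),
        exists s' r', P s' r' /\ s' T e = s T e /\ r' T e = r T e) ->
     P s r) ->
  forall s r, provable S s r -> P s r.
Proof.
move=> Hbase Htrans Hclos; fix IH 3 => s r [{}s {}r /Hbase //|{}s {}r q sr rq|{}s {}r sO rO near].
- exact: Htrans (IH _ _ sr) (IH _ _ rq).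
- apply: Hclos => // T e; case: (near T e) => s' [r' [sr' E]].
  by exists s', r'; split; [apply: IH|].
Qed.

(** Reflexivity is not a rule of [provable]; it comes from inserting some member of the basis into a
    term that ignores the distinguished slot. *)
Class nonempty_basis (S : pseudoid -> Prop) : Prop := basis_member : exists p, S p.

Section Provability.
Variable S : pseudoid -> Prop.
Variable A : finType.
Implicit Types u v w : Omega A.

Definition Oprov u v := provable S (sval u) (sval v).
Local Notation "u === v" := (Oprov u v) (at level 70).

Lemma Sigma0_mul (s r : impl A) w : Sigma0 S s r ->
  Sigma0 S (om_mul (sval w) s) (om_mul (sval w) r) /\
  Sigma0 S (om_mul s (sval w)) (om_mul r (sval w)).
Proof.
case=> p [phi [t [ws [Sp [hphi [wsO srE]]]]]].
split; exists p, phi;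
  [exists (MMul (MVar 1) (mterm_shift t)) | exists (MMul (mterm_shift t) (MVar 1))];
  exists (sval w :: ws); do ![split=> //]; try (by case=> [|i] /=; [apply: svalP|apply: wsO]);
  by rewrite /= !mterm_eval_shift; case: srE => -[-> ->]; [left|right].
Qed.

Lemma provable_mul (s r : impl A) w : provable S s r ->
  provable S (om_mul (sval w) s) (om_mul (sval w) r) /\
  provable S (om_mul s (sval w)) (om_mul r (sval w)).
Proof.
elim/provable_nested_ind=>
  [{}s {}r /(Sigma0_mul w) [? ?]|{}s {}r q [IH1 IH1'] [IH2 IH2']|{}s {}r sO rO IH].
- by split; apply: prov_base.
- by split; [apply: prov_trans IH1 IH2 | apply: prov_trans IH1' IH2'].
- split; apply: prov_closure;
   try (exact: (inOmega_mul w (exist _ _ sO))); try (exact: (inOmega_mul w (exist _ _ rO)));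
   try (exact: (inOmega_mul (exist _ _ sO) w)); try (exact: (inOmega_mul (exist _ _ rO) w));
   move=> T e; have [s' [r' [[pl pr] [sE rE]]]] := IH T e.
   + by exists (om_mul (sval w) s'), (om_mul (sval w) r'); rewrite /om_mul sE rE.
   + by exists (om_mul s' (sval w)), (om_mul r' (sval w)); rewrite /om_mul sE rE.
Qed.

Lemma OprovMl w u v : u === v -> w ** u === w ** v.
Proof. by case/(provable_mul w). Qed.

Lemma OprovMr w u v : u === v -> u ** w === v ** w.
Proof. by case/(provable_mul w). Qed.

Lemma Oprov_sym u v : u === v -> v === u.
Proof.
rewrite /Oprov; elim/provable_nested_ind=>
  [s r [p [phi [t [ws [Sp [hphi [wsO srE]]]]]]]|s r q IH1 IH2|s r sO rO IH].
- apply: prov_base; exists p, phi, t, ws; do ![split=> //].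
  by case: srE => -[-> ->]; [right|left].
- exact: prov_trans IH2 IH1.
- apply: prov_closure => // T e; have [s' [r' [rs [sE rE]]]] := IH T e.
  by exists r', s'.
Qed.

Lemma Oprov_trans u v w : u === v -> v === w -> u === w.
Proof. exact: prov_trans. Qed.

Lemma Oprov_closure u v :
  (forall T e, exists u' v', [/\ u' === v', sval u' T e = sval u T e & sval v' T e = sval v T e]) ->
  u === v.
Proof.
move=> uv; apply: prov_closure; try exact: svalP.
by move=> T e; have [u' [v' [? ? ?]]] := uv T e; exists (sval u'), (sval v').
Qed.

Lemma provable_subst p (z : pi_alph p -> Omega A) : S p ->
  provable S (subst_impl z (pi_lhs p)) (subst_impl z (pi_rhs p)).
Proof.
move=> Sp; apply: prov_base; exists p, (subst_impl z), (MVar 0), [::].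
split=> //; split; first exact: cont_hom_subst.
by split=> [i|]; [rewrite nth_nil; apply: inOmega_one | left].
Qed.

Context {S_nonempty : nonempty_basis S}.

Lemma Oprov_refl u : u === u.
Proof.
have [p Sp] : exists p, S p := S_nonempty; apply: prov_base.
exists p, (subst_impl (fun=> Oone)), (MVar 1), [:: sval u].
split=> //; split; first exact: cont_hom_subst.
split=> [[|i] /=|]; [exact: svalP | by rewrite nth_nil; apply: inOmega_one | by left].
Qed.

Lemma OprovM u u' v v' : u === u' -> v === v' -> u ** v === u' ** v'.
Proof. by move=> uu' vv'; apply: Oprov_trans (OprovMl _ vv'); apply: OprovMr. Qed.

Lemma Oprov_equivalence : Equivalence Oprov.
Proof. by split; [exact: Oprov_refl | exact: Oprov_sym | exact: Oprov_trans]. Qed.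

Lemma OprovX u v n : u === v -> Oexp u n === Oexp v n.
Proof. by move=> uv; elim: n => [|n IH] /=; [apply: Oprov_refl | apply: OprovM]. Qed.

(** In each finite monoid the omega power agrees with one finite power, where the congruence
    property applies; the closure rule passes to the limit. *)
Lemma Oprov_omega u v : u === v -> Oomega u === Oomega v.
Proof.
move=> uv; apply: Oprov_closure => T e.
by exists (Oexp u (#|T|)`!), (Oexp v (#|T|)`!); rewrite !OexpE; split=> //; apply: OprovX.
Qed.

Lemma Oprov_idem_exp u n : u ** u === u -> Oexp u n.+1 === u.
Proof.
move=> uu; elim: n => [|n IH]; first by rewrite /= Omulr1; apply: Oprov_refl.
exact: Oprov_trans (OprovMl u IH) uu.
Qed.

Lemma Oprov_idem_omega u : u ** u === u -> Oomega u === u.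
Proof.
move=> uu; apply: Oprov_closure => T e.
exists (Oexp u (#|T|)`!), u; rewrite OexpE; split=> //.
by rewrite -(prednK (fact_gt0 _)); apply: Oprov_idem_exp.
Qed.

End Provability.

#[export] Hint Extern 0 (Oprov _ _ _) => reflexivity : core.
#[export] Existing Instance Oprov_equivalence.

#[export] Instance Omul_proper S (A : finType) : nonempty_basis S ->
  Proper (@Oprov S A ==> @Oprov S A ==> @Oprov S A) (@Omul A).
Proof. by move=> ? u u' uu' v v' vv'; apply: OprovM. Qed.

#[export] Instance Oomega_proper S (A : finType) : nonempty_basis S ->
  Proper (@Oprov S A ==> @Oprov S A) (@Oomega A).
Proof. by move=> ? u u' uu'; apply: Oprov_omega. Qed.

(** * Derivations in DA *)

(** The interface through which all later derivations use a basis, so that both bases are treated at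
    once. *)
Definition proves_DA (S : pseudoid -> Prop) : Prop :=
  [/\ nonempty_basis S,
      forall (A : finType) (x : Omega A), Oprov S (Oomega x ** x) (Oomega x)
    & forall (A : finType) (x y : Omega A),
        Oprov S (Oomega (x ** y) ** Oomega (y ** x) ** Oomega (x ** y)) (Oomega (x ** y))].

Section DerivationsInDA.
Variables (S : pseudoid -> Prop) (A : finType).
Implicit Types (u v w x y e f g : Omega A) (C D : {set A}).
Local Notation "u === v" := (Oprov S u v) (at level 70).

Hypothesis S_DA : proves_DA S.
#[local] Instance S_nonempty : nonempty_basis S. Proof. by case: S_DA. Qed.
Let aper x : Oomega x ** x === Oomega x. Proof. by case: S_DA. Qed.
Let DS x y : Oomega (x ** y) ** Oomega (y ** x) ** Oomega (x ** y) === Oomega (x ** y).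
Proof. by case: S_DA. Qed.

(* Iterating gives [u^k e v^k === e] for all [k], hence [u^omega e v^omega === e]
   by closure, and [u^omega], [v^omega] absorb [u], [v]. *)
Lemma Oprov_aper_unit e u v : u ** e ** v === e -> u ** e === e /\ e ** v === e.
Proof.
move=> uev.
have expSr w n : Oexp w n.+1 = Oexp w n ** w.
  by elim: n => [|n IH] /=; rewrite ?Omul1 ?Omulr1 // -OmulA -IH.
have Euev k : Oexp u k ** e ** Oexp v k === e.
  elim: k => [|k IH]; first by rewrite /= Omul1 Omulr1.
  have -> : Oexp u k.+1 ** e ** Oexp v k.+1 = Oexp u k ** (u ** e ** v) ** Oexp v k.
    by rewrite expSr !OmulA.
  by rewrite uev.
have E : Oomega u ** e ** Oomega v === e.
  apply: Oprov_closure => T h.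
  exists (Oexp u (#|T|)`! ** e ** Oexp v (#|T|)`!), e; split=> //.
  by rewrite /= /om_mul !OexpE.
split; rewrite -{1}E.
- by rewrite !OmulA Oomega_comm aper E.
- by rewrite -!OmulA aper OmulA E.
Qed.

(* Apply the second pseudoidentity to [x := e x] and [y := y e]: here [(xy)^omega]
   becomes [e], and [(yx)^omega] becomes [y e x]. *)
Lemma Oprov_sandwich_cut e x y : e ** e === e -> e ** x ** y ** e === e ->
  e ** x ** e === e /\ e ** y ** e === e.
Proof.
move=> ee exye.
have XY : Oomega ((e ** x) ** (y ** e)) === e.
  by rewrite !OmulA exye; apply: Oprov_idem_omega.
have YX : Oomega ((y ** e) ** (e ** x)) === y ** e ** x.
  rewrite -aper OmulA -Oomega_swap XY.
  have -> : y ** e ** e ** (e ** x) = y ** (e ** e ** e) ** x by rewrite !OmulA.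
  by rewrite !ee.
(* Here [E] reads [e y e x e === e]: multiplying by [e y] on the left and [x e] on the right fixes
   [e], and aperiodicity separates the two sides. *)
have := DS (e ** x) (y ** e); rewrite XY YX => E.
have [|eye exe] := @Oprov_aper_unit e (e ** y) (x ** e).
  by rewrite -{4}E !OmulA.
by split=> //; rewrite -OmulA.
Qed.

(** For the pair [e], [y e x] the two omega powers become the idempotents [e x] and [y e], so the
    second law gives [e x y e e x === e x]; multiplying by [e] on the right finishes. *)
Lemma Oprov_sandwich_mul e x y : e ** e === e ->
  e ** x ** e === e -> e ** y ** e === e -> e ** (x ** y) ** e === e.
Proof.
move=> ee exe eye.
have XY : Oomega (e ** (y ** e ** x)) === e ** x.
  by rewrite !OmulA eye; apply: Oprov_idem_omega => //; rewrite OmulA exe.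
have YX : Oomega ((y ** e ** x) ** e) === y ** e.
  have -> : y ** e ** x ** e = y ** (e ** x ** e) by rewrite !OmulA.
  rewrite exe; apply: Oprov_idem_omega => //.
  have -> : y ** e ** (y ** e) = y ** (e ** y ** e) by rewrite !OmulA.
  by rewrite eye.
have := DS e (y ** e ** x); rewrite XY YX => E.
transitivity (e ** x ** (y ** e) ** (e ** x) ** e); last by rewrite E.
have -> : e ** x ** (y ** e) ** (e ** x) ** e = e ** x ** y ** e ** (e ** x ** e).
  by rewrite !OmulA.
by rewrite exe -(OmulA _ e) ee !OmulA.
Qed.

(** Membership in the topological closure of the submonoid generated by [C]. *)
Definition within C u := forall (T : finMonoid) (h : A -> T),
  exists2 w : seq A, {subset w <= C} & sval u T h = sval (Oword w) T h.

(** Occurrence is asked only up to provable equality, so that it passes to omega powers through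
    [u^omega u === u^omega]. *)
Definition has_letter a u := exists p q, u === p ** Ovar a ** q.

Definition spans C u := within C u /\ {in C, forall a, has_letter a u}.

Lemma within_sub C D u : C \subset D -> within C u -> within D u.
Proof.
move=> /subsetP CD uC T h; have [w wC ->] := uC T h.
by exists w => // a /wC /CD.
Qed.

Lemma within_word C (w : seq A) : {subset w <= C} -> within C (Oword w).
Proof. by move=> wC T h; exists w. Qed.

Lemma within_mul C u v : within C u -> within C v -> within C (u ** v).
Proof.
move=> uC vC T h; have [w1 w1C E1] := uC T h; have [w2 w2C E2] := vC T h.
exists (w1 ++ w2); first by move=> a; rewrite mem_cat => /orP [/w1C|/w2C].
by rewrite Oword_cat /= /om_mul E1 E2.
Qed.

Lemma within_omega C u : within C u -> within C (Oomega u).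
Proof.
move=> uC T h.
have exp_within n : within C (Oexp u n).
  by elim: n => [|n IH]; [apply: (@within_word C [::]) | apply: within_mul].
by have [w wC E] := exp_within (#|T|)`! T h; exists w; rewrite // -E OexpE.
Qed.

Lemma has_letter_prov a u v : u === v -> has_letter a u -> has_letter a v.
Proof. by move=> uv [p [q E]]; exists p, q; rewrite -uv. Qed.

Lemma has_letter_mull a u v : has_letter a u -> has_letter a (u ** v).
Proof. by case=> p [q E]; exists p, (q ** v); rewrite E !OmulA. Qed.

Lemma has_letter_mulr a u v : has_letter a v -> has_letter a (u ** v).
Proof. by case=> p [q E]; exists (u ** p), q; rewrite E !OmulA. Qed.

Lemma has_letter_omega a u : has_letter a u -> has_letter a (Oomega u).
Proof. by move=> au; apply: has_letter_prov (aper u) _; apply: has_letter_mulr. Qed.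

(** Closure replaces [u] by a word over [C], whose letters are then absorbed one by one. *)
Lemma Oprov_sandwich_within C e u : e ** e === e ->
  {in C, forall a, e ** Ovar a ** e === e} -> within C u -> e ** u ** e === e.
Proof.
move=> ee eCe uC; apply: Oprov_closure => T h; have [w wC E] := uC T h.
exists (e ** Oword w ** e), e; split=> //; last by rewrite /= /om_mul E.
elim: w wC {E} => [|a w IH] wC /=; first by rewrite Omulr1.
apply: Oprov_sandwich_mul => //; first by apply/eCe/wC; rewrite mem_head.
by apply: IH => b bw; apply: wC; rewrite inE bw orbT.
Qed.

(** With [e] the omega power of [w] and [w === p a q], aperiodicity gives [e p a q e === e]. Cutting
    off [p] and then [q] leaves [e a e === e] for each letter [a] of [C]. *)
Lemma Oprov_omega_sandwich C w u : spans C w -> within C u ->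
  Oomega w ** u ** Oomega w === Oomega w.
Proof.
move=> [_ wC]; apply: Oprov_sandwich_within; rewrite ?Oomega_idem // => a /wC [p [q E]].
set e := Oomega w; have ee : e ** e === e by rewrite /e Oomega_idem.
have [|_ eaqe] := @Oprov_sandwich_cut e p (Ovar a ** q) ee.
  have -> : e ** p ** (Ovar a ** q) ** e = e ** (p ** Ovar a ** q) ** e by rewrite !OmulA.
  by rewrite -E aper.
by have [|] := @Oprov_sandwich_cut e (Ovar a) q ee; rewrite // -(OmulA e).
Qed.

(** Expanding [v^omega] to [v^omega w^omega v^omega] puts [u v^omega] between two copies of
    [w^omega]. *)
Lemma Oprov_omega_absorb C w v u : spans C w -> spans C v -> within C u ->
  Oomega w ** u ** Oomega v === Oomega w ** Oomega v.
Proof.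
move=> wC vC uC.
have ewv := Oprov_omega_sandwich wC (within_omega vC.1).
have evw := Oprov_omega_sandwich vC (within_omega wC.1).
rewrite -{1}evw.
have -> : Oomega w ** u ** (Oomega v ** Oomega w ** Oomega v) =
  Oomega w ** (u ** Oomega v) ** Oomega w ** Oomega v by rewrite !OmulA.
by rewrite (Oprov_omega_sandwich wC) //; apply: within_mul => //; apply/within_omega/vC.1.
Qed.

End DerivationsInDA.

(** * Both bases yield the laws of DA *)

Lemma proves_DA_SigmaSet : proves_DA SigmaSet.
Proof.
split=> [|A x|A x y]; first by exists pid_aper; left.
- exact: (@provable_subst _ A pid_aper (fun=> x) (or_introl erefl)).
- exact: (@provable_subst _ A pid_DS (fun i => if val i is 0 then x else y)
    (or_intror erefl)).
Qed.

#[local] Instance GammaSet_nonempty : nonempty_basis GammaSet.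
Proof. by exists pid_Gamma. Qed.

Lemma proves_DA_GammaSet : proves_DA GammaSet.
Proof.
have G A (x y : Omega A) : Oprov GammaSet
    (Oomega (x ** y) ** x ** (Oomega (x ** y) ** x)) (Oomega (x ** y) ** x).
  exact: (@provable_subst _ A pid_Gamma (fun i => if val i is 0 then x else y) erefl).
(* At [y = 1] the law makes [x^omega x] idempotent, hence provably equal to its own omega power,
   which is [x^omega]. *)
have aper A (x : Omega A) : Oprov GammaSet (Oomega x ** x) (Oomega x).
  symmetry; rewrite -{1}Oomega_omegaM; apply: Oprov_idem_omega.
  by have := G A x Oone; rewrite Omulr1.
split=> [|//|A x y]; first exact: GammaSet_nonempty.
set e := Oomega (x ** y); set f := Oomega (y ** x).
(* Write the last [e] as [e x y] and use that [e x] is idempotent. *)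
have exe : Oprov GammaSet (e ** x ** e) e.
  transitivity (e ** x ** (e ** x) ** y).
    by rewrite -!OmulA aper.
  by rewrite G -OmulA aper.
(* Write the first [e] as [x y e] and move [y] across the omega powers: the square of the idempotent
   [f y] appears. *)
have eye : Oprov GammaSet (e ** y ** e) e.
  have ye : y ** e = f ** y by apply: Oomega_swap.
  have xye : Oprov GammaSet (x ** y ** e) e by rewrite Oomega_comm aper.
  rewrite -{1}xye.
  have -> : x ** y ** e ** y ** e = x ** (f ** y ** (f ** y)) by rewrite -ye !OmulA.
  by rewrite G -ye OmulA.
have -> : Oprov GammaSet f (y ** e ** x).
  by rewrite /f -aper OmulA -Oomega_swap.
by rewrite !OmulA eye exe.
Qed.

(** * Splitting words at first and last occurrences *)

Section FirstLast.
Variable A : eqType.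
Implicit Types (a : A) (x y : seq A).

Definition before_first a x := take (index a x) x.
Definition after_first a x := drop (index a x).+1 x.
Definition before_last a x := rev (after_first a (rev x)).
Definition after_last a x := rev (before_first a (rev x)).

Lemma first_cat a x0 x1 : a \notin x0 ->
  before_first a (x0 ++ a :: x1) = x0 /\ after_first a (x0 ++ a :: x1) = x1.
Proof.
move=> /negPf ax0; rewrite /before_first /after_first index_cat ax0 /= eqxx addn0.
by rewrite take_size_cat // -cat_rcons drop_size_cat ?size_rcons.
Qed.

Lemma last_cat_notin a x0 x1 : a \notin x1 ->
  before_last a (x0 ++ a :: x1) = x0 /\ after_last a (x0 ++ a :: x1) = x1.
Proof.
move=> ax1; rewrite /before_last /after_last rev_cat rev_cons cat_rcons.
by have [|-> ->] := @first_cat a (rev x1) (rev x0); rewrite ?mem_rev ?revK.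
Qed.

Lemma first_split a x : a \in x ->
  x = before_first a x ++ a :: after_first a x /\ a \notin before_first a x.
Proof.
move=> ax; split; last first.
  by apply/negP => /index_ltn; rewrite ltnn.
by rewrite -{1}(cat_take_drop (index a x) x) (drop_nth a) ?index_mem // nth_index.
Qed.

Lemma last_split a x : a \in x ->
  x = before_last a x ++ a :: after_last a x /\ a \notin after_last a x.
Proof.
move=> ax; have [|E N] := @first_split a (rev x); first by rewrite mem_rev.
by rewrite mem_rev; split=> //; rewrite -{1}(revK x) E rev_cat rev_cons cat_rcons.
Qed.

End FirstLast.

(** * The congruences [sim n] on words *)

Section WordCongruence.
Variable A : finType.
Implicit Types (a : A) (x y z : seq A).

(** A class is coded by its finite tree of splittings, with [None] for an absent letter; finite
    index is thus built in. *)
Fixpoint sim_class (n : nat) : finType :=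
  if n is n'.+1
  then {ffun A -> option (sim_class n' * sim_class n' * (sim_class n' * sim_class n'))}
  else unit.

Fixpoint sim_cls n x : sim_class n :=
  if n is n'.+1 then
    [ffun a => if a \in x then
       Some (sim_cls n' (before_first a x), sim_cls n' (after_first a x),
             (sim_cls n' (before_last a x), sim_cls n' (after_last a x)))
     else None]
  else tt.

Lemma sim_clsS n x a : sim_cls n.+1 x a =
  if a \in x then
    Some (sim_cls n (before_first a x), sim_cls n (after_first a x),
          (sim_cls n (before_last a x), sim_cls n (after_last a x)))
  else None.
Proof. by rewrite ffunE. Qed.

Definition sim n x y := sim_cls n x = sim_cls n y.

Lemma simS_first n x0 a x1 y : sim n.+1 (x0 ++ a :: x1) y -> a \notin x0 ->
  exists y0 y1, [/\ y = y0 ++ a :: y1, a \notin y0, sim n x0 y0 & sim n x1 y1].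
Proof.
move=> /ffunP /(_ a); rewrite !sim_clsS mem_cat mem_head orbT => + ax0.
have [-> ->] := first_cat x1 ax0.
case: ifP => // /first_split [yE ay0] [? ? _ _].
by exists (before_first a y), (after_first a y).
Qed.

Lemma simS_last n x0 a x1 y : sim n.+1 (x0 ++ a :: x1) y -> a \notin x1 ->
  exists y0 y1, [/\ y = y0 ++ a :: y1, a \notin y1, sim n x0 y0 & sim n x1 y1].
Proof.
move=> /ffunP /(_ a); rewrite !sim_clsS mem_cat mem_head orbT => + ax1.
have [-> ->] := last_cat_notin x0 ax1.
case: ifP => // /last_split [yE ay1] [_ _ ? ?].
by exists (before_last a y), (after_last a y).
Qed.

Lemma simS_mem n x y : sim n.+1 x y -> x =i y.
Proof. by move=> /ffunP xy a; have := xy a; rewrite !sim_clsS; do 2!case: ifP. Qed.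

Lemma simS n x y : x =i y ->
  (forall a, a \in x -> exists x0 x1 y0 y1,
     [/\ x = x0 ++ a :: x1, a \notin x0, y = y0 ++ a :: y1, a \notin y0
       & sim n x0 y0 /\ sim n x1 y1]) ->
  (forall a, a \in x -> exists x0 x1 y0 y1,
     [/\ x = x0 ++ a :: x1, a \notin x1, y = y0 ++ a :: y1, a \notin y1
       & sim n x0 y0 /\ sim n x1 y1]) ->
  sim n.+1 x y.
Proof.
move=> xy Hf Hl; apply/ffunP => a; rewrite !sim_clsS -xy; case: ifP => // ax.
have [x0 [x1 [y0 [y1 [xE ax0 yE ay0 [E0 E1]]]]]] := Hf a ax.
have [] := first_cat x1 ax0; have [] := first_cat y1 ay0; rewrite -xE -yE => -> -> -> ->.
have [x2 [x3 [y2 [y3 [xE' ax3 yE' ay3 [E2 E3]]]]]] := Hl a ax.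
have [] := last_cat_notin x2 ax3; have [] := last_cat_notin y2 ay3.
by rewrite -xE' -yE' => -> -> -> ->; rewrite E0 E1 E2 E3.
Qed.

Lemma sim_mem_split n x y : sim n.+1 x y ->
  [/\ x =i y,
      forall a, a \in x -> exists x0 x1 y0 y1,
       [/\ x = x0 ++ a :: x1, a \notin x0, y = y0 ++ a :: y1, a \notin y0
         & sim n x0 y0 /\ sim n x1 y1]
    & forall a, a \in x -> exists x0 x1 y0 y1,
       [/\ x = x0 ++ a :: x1, a \notin x1, y = y0 ++ a :: y1, a \notin y1
         & sim n x0 y0 /\ sim n x1 y1]].
Proof.
move=> xy; split=> [|a ax|a ax]; first exact: simS_mem xy.
- have [xE ax0] := first_split ax; rewrite xE in xy.
  by have [y0 [y1 [-> ay0 ? ?]]] := simS_first xy ax0;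
    exists (before_first a x), (after_first a x), y0, y1.
- have [xE ax1] := last_split ax; rewrite xE in xy.
  by have [y0 [y1 [-> ay1 ? ?]]] := simS_last xy ax1;
    exists (before_last a x), (after_last a x), y0, y1.
Qed.

Lemma sim_pred n x y : sim n.+1 x y -> sim n x y.
Proof.
elim: n x y => [|n IH] x y; first by [].
move=> /sim_mem_split [xy Hf Hl]; apply: simS => // a ax.
- have [x0 [x1 [y0 [y1 [? ? ? ? [/IH ? /IH ?]]]]]] := Hf a ax.
  by exists x0, x1, y0, y1.
- have [x0 [x1 [y0 [y1 [? ? ? ? [/IH ? /IH ?]]]]]] := Hl a ax.
  by exists x0, x1, y0, y1.
Qed.

Lemma sim_le m n x y : m <= n -> sim n x y -> sim m x y.
Proof. by move=> /subnKC <-; elim: (n - m) => [|k IH]; rewrite ?addn0 // addnS => /sim_pred. Qed.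

(** The first occurrence of a letter in a product lies in the left factor if the letter occurs
    there, otherwise in the right one; last occurrences are dual. Each cut leaves a factor or a
    product of factors one level lower. *)
Lemma sim_cat n x x' y y' : sim n x x' -> sim n y y' -> sim n (x ++ y) (x' ++ y').
Proof.
elim: n x x' y y' => // n IH x x' y y' xx' yy'.
have [xm xf xl] := sim_mem_split xx'; have [ym yf yl] := sim_mem_split yy'.
apply: simS => [a|a|a]; first by rewrite !mem_cat xm ym.
- have [ax _|ax] := boolP (a \in x).
    have [x0 [x1 [y0 [y1 [-> ? -> ? [? ?]]]]]] := xf a ax.
    exists x0, (x1 ++ y), y0, (y1 ++ y'); rewrite -!catA; split=> //; split=> //.
    by apply: IH => //; apply: sim_pred.
  rewrite mem_cat (negPf ax) => /yf [x0 [x1 [y0 [y1 [-> ? -> ? [? ?]]]]]].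
  exists (x ++ x0), x1, (x' ++ y0), y1; rewrite -!catA !mem_cat -xm !negb_or ax; split=> //=.
  by split=> //; apply: IH => //; apply: sim_pred.
- have [ay _|ay] := boolP (a \in y).
    have [x0 [x1 [y0 [y1 [-> ? -> ? [? ?]]]]]] := yl a ay.
    exists (x ++ x0), x1, (x' ++ y0), y1; rewrite -!catA; split=> //; split=> //.
    by apply: IH => //; apply: sim_pred.
  rewrite mem_cat (negPf ay) orbF => /xl [x0 [x1 [y0 [y1 [-> ? -> ? [? ?]]]]]].
  exists x0, (x1 ++ y), y0, (y1 ++ y'); rewrite -!catA !mem_cat -ym !negb_or ay.
  rewrite !andbT; split=> //; split=> //.
  by apply: IH => //; apply: sim_pred.
Qed.

Fixpoint wpow x n := if n is n'.+1 then x ++ wpow x n' else [::].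

(** Every first occurrence lies in the first copy of [x] and every last one in the last copy of [y].
    A cut spends one level and one copy, and the induction hypothesis handles the rest. *)
Lemma sim_absorb n x y z z' : x =i y -> {subset z <= x} -> {subset z' <= x} ->
  sim n (wpow x n ++ z ++ wpow y n) (wpow x n ++ z' ++ wpow y n).
Proof.
move=> xy; elim: n z z' => // n IH z z' zx z'x.
have wpowS w : wpow w n.+1 = wpow w n ++ w.
  by elim: {z z' zx z'x IH}n => [|n IH] /=; rewrite ?cats0 // -catA -IH.
have mid r w w' : {subset w <= x} -> {subset w' <= x} ->
    sim n (wpow x n ++ w ++ wpow y n ++ r) (wpow x n ++ w' ++ wpow y n ++ r).
  move=> wx w'x; have := sim_cat (IH _ _ wx w'x) (erefl : sim n r r).
  by rewrite -!catA.
have mem_pow w a k : (a \in wpow w k) -> a \in w.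
  by elim: k => //= k IHk; rewrite mem_cat => /orP [].
have in_x w a : {subset w <= x} -> a \in wpow x n.+1 ++ w ++ wpow y n.+1 -> a \in x.
  move=> wx; rewrite mem_cat => /orP [/mem_pow //|]; rewrite mem_cat => /orP [/wx //|/mem_pow].
  by rewrite xy.
apply: simS => [a|a /(in_x _ _ zx) ax|a /(in_x _ _ zx) ax].
- by apply/idP/idP => /in_x ax; rewrite mem_cat wpowS mem_cat ax // orbT.
- have [E N] := first_split ax.
  have {}E r : x ++ r = before_first a x ++ a :: (after_first a x ++ r) by rewrite {1}E -catA.
  exists (before_first a x), (after_first a x ++ wpow x n ++ z ++ wpow y n.+1).
  exists (before_first a x), (after_first a x ++ wpow x n ++ z' ++ wpow y n.+1).
  split; rewrite // /= -?catA ?E //; split=> //.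
  by apply: sim_cat => //; rewrite -/(wpow y n.+1) wpowS; apply: mid.
- have ay : a \in y by rewrite -xy.
  have [E N] := last_split ay.
  have {}E r : r ++ y = (r ++ before_last a y) ++ a :: after_last a y by rewrite {1}E catA.
  exists ((wpow x n.+1 ++ z ++ wpow y n) ++ before_last a y), (after_last a y).
  exists ((wpow x n.+1 ++ z' ++ wpow y n) ++ before_last a y), (after_last a y).
  split; rewrite // ?(wpowS y) ?catA ?E -?catA //; split=> //.
  by apply: (@sim_cat n x x) => //; apply: mid.
Qed.

End WordCongruence.

(** * Finite quotients of the free monoid *)

Section ImageMonoid.
Variables (A : Type) (K : finType) (c : seq A -> K).
Hypothesis c_cat : forall x x' y y', c x = c x' -> c y = c y' -> c (x ++ y) = c (x' ++ y').

(** The quotient by the kernel of [c] is carried by the attained values of [c], so that every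
    element is the class of a word. *)
Definition img := {k : K | `[< exists x, c x = k >]}.

Definition img_cls (x : seq A) : img := exist _ (c x) (asboolT (ex_intro _ x erefl)).

Definition img_rep (k : img) : seq A := sval (cid (asboolW (valP k))).

Lemma img_eq x y : c x = c y -> img_cls x = img_cls y.
Proof. by move=> xy; apply: val_inj. Qed.

Lemma img_repK k : img_cls (img_rep k) = k.
Proof. by apply: val_inj; rewrite /= /img_rep; case: cid. Qed.

Definition img_mul (k l : img) : img := img_cls (img_rep k ++ img_rep l).

Lemma img_mulE x y : img_mul (img_cls x) (img_cls y) = img_cls (x ++ y).
Proof.
by apply/img_eq/c_cat; [have := img_repK (img_cls x) | have := img_repK (img_cls y)];
  move=> /(congr1 val).
Qed.

Lemma img_mulA k l m : img_mul k (img_mul l m) = img_mul (img_mul k l) m.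
Proof. by rewrite -(img_repK k) -(img_repK l) -(img_repK m) !img_mulE catA. Qed.

Lemma img_mul1 k : img_mul (img_cls [::]) k = k.
Proof. by rewrite -(img_repK k) img_mulE. Qed.

Lemma img_mul1r k : img_mul k (img_cls [::]) = k.
Proof. by rewrite -(img_repK k) img_mulE cats0. Qed.

Definition img_monoid : finMonoid :=
  @FinMonoid img img_mul (img_cls [::]) img_mulA img_mul1 img_mul1r.

Definition img_gen (a : A) : img_monoid := img_cls [:: a].

End ImageMonoid.

(** * The finite quotients lie in DA *)

Section SimMonoid.
Local Open Scope fm_scope.
Variables (A : finType) (n : nat).
Implicit Types x y z : seq A.

Definition simM : finMonoid := img_monoid (@sim_cat A n).
Definition sim_img x : simM := img_cls (@sim_cls A n) x.

Lemma sim_imgM x y : sim_img (x ++ y) = sim_img x * sim_img y.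
Proof. by rewrite /sim_img -(img_mulE (@sim_cat A n)). Qed.

Lemma sim_imgX x k : sim_img (wpow x k) = fm_exp (sim_img x) k.
Proof. by elim: k => //= k IH; rewrite sim_imgM IH. Qed.

Lemma sim_img_surj (t : simM) : exists x, t = sim_img x.
Proof. by exists (img_rep t); rewrite /sim_img img_repK. Qed.

Lemma sim_img_omega x : exists2 u, u =i x & fm_omega (sim_img x) = sim_img u.
Proof.
exists (wpow x (#|simM|)`!); last by rewrite sim_imgX.
rewrite -(prednK (fact_gt0 #|simM|)) => a; elim: _.-1 => [|k IH]; rewrite /= ?cats0 //.
by rewrite mem_cat -/(wpow x k.+1) IH orbb.
Qed.

Lemma sim_img_absorb x y z z' : x =i y -> {subset z <= x} -> {subset z' <= x} ->
  fm_omega (sim_img x) * sim_img z * fm_omega (sim_img y) =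
  fm_omega (sim_img x) * sim_img z' * fm_omega (sim_img y).
Proof.
(* The exponent is [n.+1] because an idempotent equals its positive powers only and [n] may be 0;
   the surplus level is dropped by [sim_pred]. *)
have omE (t : simM) : fm_omega t = fm_exp (fm_omega t) n.+1.
  by rewrite fm_exp_idem ?fm_omega_idem.
move=> xy zx z'x; rewrite omE (omE (sim_img y)).
have [u ux ->] := sim_img_omega x; have [v vy ->] := sim_img_omega y.
rewrite -!sim_imgX -!sim_imgM -!(catA (wpow u _)); apply/img_eq/sim_pred; apply: sim_absorb.
- by move=> a; rewrite ux xy vy.
- by move=> a /zx; rewrite ux.
- by move=> a /z'x; rewrite ux.
Qed.

Lemma simM_omega_sandwich x z : {subset z <= x} ->
  fm_omega (sim_img x) * sim_img z * fm_omega (sim_img x) = fm_omega (sim_img x).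
Proof.
move=> zx; rewrite (@sim_img_absorb x x z [::]) //.
by rewrite (fm_mul1r (fm_omega _)) fm_omega_idem.
Qed.

Lemma simM_SigmaSet : models SigmaSet simM.
Proof.
move=> p [] -> e.
- have [x E] := sim_img_surj (e lx1).
  rewrite /pi_lhs /pi_rhs /pid_aper /om_omega1 /om_mul /om_omega /om_var E.
  rewrite -[RHS](simM_omega_sandwich (z := x)) //.
  by rewrite -[RHS]fm_mulA fm_omega_comm [RHS]fm_mulA fm_omega_idem.
- have [x Ex] := sim_img_surj (e lx); have [y Ey] := sim_img_surj (e ly).
  rewrite /pi_lhs /pi_rhs /pid_DS /om_mul /om_omega /om_var Ex Ey -(sim_imgM x y) -(sim_imgM y x).
  have [u uE ->] := sim_img_omega (y ++ x); rewrite simM_omega_sandwich //.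
  by move=> a; rewrite uE !mem_cat orbC.
Qed.

Lemma simM_GammaSet : models GammaSet simM.
Proof.
move=> p -> e.
have [x Ex] := sim_img_surj (e lx); have [y Ey] := sim_img_surj (e ly).
rewrite /pi_lhs /pi_rhs /pid_Gamma /om_mul /om_omega /om_var Ex Ey.
rewrite -(sim_imgM x y); set e' := fm_omega _; set f := fm_omega (sim_img (y ++ x)).
(* Appending [f] puts both sides between omega powers of words with the same letters, where the
   middle word is immaterial. *)
have exf : e' * sim_img x = e' * sim_img x * f.
  by rewrite /e' /f !sim_imgM -fm_omega_swap -fm_mulA fm_omega_idem.
have [u uE Eu] : exists2 u, u =i x ++ y & e' = sim_img u by apply: sim_img_omega.
have -> : e' * sim_img x * (e' * sim_img x) = e' * sim_img (x ++ u ++ x) * f.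
  by rewrite !sim_imgM -Eu {2}exf !fm_mulA.
rewrite exf; apply: sim_img_absorb => a; rewrite !mem_cat ?uE ?mem_cat.
- by rewrite orbC.
- by case: (a \in x) => //=; rewrite orbF.
- by move=> ->.
Qed.

End SimMonoid.

(** * Approximating an implicit operation by a word *)

Section JointWord.
Variables (A : finType) (T : finMonoid) (e : A -> T) (n : nat).

(** Evaluate [u] in the image monoid of the pair (value in [T], class in [sim n]). The result is the
    class of a word, and both projections are homomorphisms. *)
Lemma joint_word (u : Omega A) : exists x,
  sval u T e = sval (Oword x) T e /\ sval u (simM A n) (fun a => sim_img n [:: a]) = sim_img n x.
Proof.
pose c x := (sval (Oword x) T e, sim_cls n x).
have c_cat x x' y y' : c x = c x' -> c y = c y' -> c (x ++ y) = c (x' ++ y').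
  move=> [xT xn] [yT yn]; congr (_, _); last exact: sim_cat.
  by rewrite !Oword_cat /= /om_mul xT yT.
pose M := img_monoid c_cat; pose k := sval u M (@img_gen _ _ _ c_cat).
have clsM (s t : M) : fm_mul s t = img_cls c (img_rep s ++ img_rep t) by [].
have repE x : c (img_rep (img_cls c x)) = c x.
  by have /(congr1 val) := img_repK (img_cls c x).
have repK (s : M) : val s = c (img_rep s) by rewrite -{1}(img_repK s).
exists (img_rep k); split.
- pose h (s : M) : T := (val s).1.
  have hh : fm_hom h.
    by split=> // s t; rewrite /h clsM !repK repE /c /= Oword_cat.
  have <- : h k = sval (Oword (img_rep k)) T e by rewrite /h repK.
  rewrite /k (Omega_natural _ _ hh); congr (sval u T _); apply: funext => a.
  exact: (esym (fm_mul1r (e a))).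
- pose h (s : M) : simM A n := sim_img n (img_rep s).
  have hE x : h (img_cls c x) = sim_img n x by apply: img_eq; case: (repE x).
  have hh : fm_hom h.
    split=> [|s t]; first by rewrite hE.
    by rewrite clsM hE sim_imgM.
  rewrite -[RHS]/(h k) /k (Omega_natural _ _ hh); congr (sval u _ _).
  by apply: funext => a; rewrite hE.
Qed.

End JointWord.

(** * Provably equal members of Omega with prescribed values *)

Section Content.
Variable A : finType.
Implicit Types (a : A) (x y : seq A).

Definition content x : {set A} := [set a in x].

Lemma content_cat x y : content (x ++ y) = content x :|: content y.
Proof. by apply/setP => a; rewrite !inE mem_cat. Qed.

Lemma content_cons a x : content (a :: x) = a |: content x.
Proof. by apply/setP => b; rewrite !inE. Qed.

Lemma content0 x : content x = set0 -> x = [::].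
Proof. by case: x => // a x /setP /(_ a); rewrite !inE eqxx. Qed.

(** The letter [a] is the one whose first occurrence comes last. *)
Lemma last_new_letter x : x != [::] -> exists a x0 x1,
  [/\ x = x0 ++ a :: x1, a \notin x0 & content x = a |: content x0].
Proof.
elim/last_ind: x => // x b IH _.
have [bx|bx] := boolP (b \in x); last first.
  by exists b, x, [::]; rewrite cats1 -cats1 content_cat content_cons setUC /content setU0.
have [|a [x0 [x1 [E ax0 cE]]]] := IH; first by case: x bx {IH}.
exists a, x0, (rcons x1 b); split=> //; first by rewrite E rcons_cat.
by rewrite -cE; apply/setP => c; rewrite !inE mem_rcons inE orb_idl // => /eqP ->.
Qed.

(** Dually, [a] is the letter whose last occurrence comes first. *)
Lemma first_unrepeated_letter x : x != [::] -> exists a x0 x1,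
  [/\ x = x0 ++ a :: x1, a \notin x1 & content x = a |: content x1].
Proof.
elim: x => // b x IH _.
have [bx|bx] := boolP (b \in x); last by exists b, [::], x; rewrite content_cons.
have [|a [x0 [x1 [E ax1 cE]]]] := IH; first by case: x bx {IH}.
exists a, (b :: x0), x1; split=> //; first by rewrite E.
by rewrite -cE; apply/setP => c; rewrite !inE orb_idl // => /eqP ->.
Qed.

End Content.

Section Twins.
Variables (S : pseudoid -> Prop) (A : finType) (T : finMonoid) (e : A -> T).
Hypothesis S_DA : proves_DA S.
#[local] Instance twin_basis_nonempty : nonempty_basis S. Proof. by case: S_DA. Qed.
Implicit Types (x y : seq A) (C D : {set A}) (s r u v w : Omega A).
Local Notation "u === v" := (Oprov S u v) (at level 70).
Local Notation val_of u := (sval u T e).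
Local Notation ev x := (val_of (Oword x)).

(* The words [x] and [y] need not be provably equal: they are only values, in [T],
   of provably equal members of [Omega A]. *)
Definition twin C x y := exists s r,
  [/\ s === r, spans S C s, spans S C r, val_of s = ev x & val_of r = ev y].

Lemma spans_mul C D s r : spans S C s -> spans S D r -> spans S (C :|: D) (s ** r).
Proof.
move=> [sC aC] [rD aD]; split.
  by apply: within_mul; apply: within_sub; [apply: subsetUl|exact: sC|apply: subsetUr|exact: rD].
move=> a /setUP [/aC|/aD]; first exact: has_letter_mull.
exact: has_letter_mulr.
Qed.

Lemma twin_nil : twin set0 [::] [::].
Proof.
by exists Oone, Oone; split=> //; split=> [|a]; rewrite ?inE //; apply: (@within_word _ _ [::]).
Qed.

Lemma twin_letter a : twin [set a] [:: a] [:: a].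
Proof.
have aS : spans S [set a] (Oword [:: a]).
  split; first by apply: within_word => b; rewrite !inE.
  by move=> b /set1P ->; exists Oone, Oone; rewrite /= Omul1.
by exists (Oword [:: a]), (Oword [:: a]).
Qed.

Lemma twin_cat C D x x' y y' : twin C x x' -> twin D y y' ->
  twin (C :|: D) (x ++ y) (x' ++ y').
Proof.
move=> [s [r [sr sC rC Es Er]]] [s' [r' [sr' sD rD Es' Er']]].
exists (s ** s'), (r ** r'); split; try exact: spans_mul.
- by rewrite sr sr'.
- by rewrite Oword_cat /= /om_mul Es Es'.
- by rewrite Oword_cat /= /om_mul Er Er'.
Qed.

(** The union of copies of [C] is [C], except that the empty product has empty content. *)
Lemma twin_flatten C bs : (forall b, b \in bs -> twin C b.1 b.2) ->
  twin (if bs is [::] then set0 else C) (flatten (unzip1 bs)) (flatten (unzip2 bs)).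
Proof.
elim: bs => [|b bs IH] tC; first exact: twin_nil.
have {}IH := IH (fun b' h => tC b' (@mem_behead _ (b :: bs) _ h)).
have := twin_cat (tC b (mem_head _ _)) IH.
by case: bs {IH tC} => [|b' bs]; rewrite ?setU0 ?setUid.
Qed.

(** In [T] the value of [p] absorbs any power of [w] on the right, so both sides have the value of
    [p ** q]. *)
Lemma val_omega_pump (p w q : Omega A) : val_of (p ** w) = val_of p ->
  val_of (p ** Oomega w ** q) = val_of (p ** w ** q).
Proof.
rewrite /= /om_mul => E; congr (fm_mul _ _); rewrite E /om_omega /fm_omega.
by elim: _`! => [|n IH]; rewrite ?fm_mul1r // fm_expSr fm_mulA IH.
Qed.

(* Pigeonhole on the pairs of values of the prefixes: some nonempty block [w], [v]
   of factors can be replaced by its omega power in both words simultaneously. *)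
Lemma twin_pump C bs : #|T| * #|T| < size bs -> (forall b, b \in bs -> twin C b.1 b.2) ->
  exists p w q p' w' q',
    [/\ p === p', w === w' & q === q'] /\ [/\ within C p, within C p', within C q & within C q'] /\
    [/\ spans S C w, spans S C w',
        val_of (p ** Oomega w ** q) = ev (flatten (unzip1 bs))
      & val_of (p' ** Oomega w' ** q') = ev (flatten (unzip2 bs))].
Proof.
move=> lt_bs tC.
pose f (i : 'I_(size bs).+1) :=
  (ev (flatten (unzip1 (take i bs))), ev (flatten (unzip2 (take i bs)))).
have /injectivePn [i [j ij fij]] : ~~ injectiveb f.
  apply/injectiveP => /leq_card; rewrite card_ord card_prod leqNgt.
  by rewrite (leq_trans lt_bs).
wlog {ij} lt_ij : i j fij / i < j.
  move=> W; case: (ltngtP i j) => [/(W _ _ fij) //|/(W _ _ (esym fij)) //|/val_inj/eqP].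
  by rewrite (negPf ij).
have tj : take j bs = take i bs ++ drop i (take j bs).
  by rewrite -{1}(cat_take_drop i (take j bs)) take_takel // ltnW.
have E3 : bs = take i bs ++ drop i (take j bs) ++ drop j bs by rewrite catA -tj cat_take_drop.
case: fij; rewrite {}tj.
have : drop i (take j bs) != [::].
  by rewrite -size_eq0 size_drop size_takel -1?ltnS ?ltn_ord // subn_eq0 -ltnNge.
move: E3; move: (take i bs) (drop i _) (drop j _) => b1 b2 b3 E3; move: tC; rewrite {}E3.
move=> tC b2n0; rewrite /unzip1 /unzip2 !map_cat !flatten_cat !Oword_cat => E1 E2.
have sub b0 : {subset b0 <= b1 ++ b2 ++ b3} -> twin (if b0 is [::] then set0 else C) _ _ :=
  fun h => twin_flatten (fun b bb0 => tC b (h b bb0)).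
(* The outer blocks may be empty, so only an upper bound on their content is kept; the middle block
   is nonempty and has content exactly [C]. *)
have within_if b0 s : spans S (if b0 is [::] then set0 else C) s -> within C s.
  by case=> + _; apply: within_sub; case: (b0) => *; rewrite ?sub0set.
have [|p [p' [pE /within_if pC /within_if pC' pv pv']]] := sub b1.
  by move=> b; rewrite !mem_cat => ->.
have [|q [q' [qE /within_if qC /within_if qC' qv qv']]] := sub b3.
  by move=> b; rewrite !mem_cat => ->; rewrite !orbT.
have [|w [w' [wE]]] := sub b2.
  by move=> b; rewrite !mem_cat => ->; rewrite orbT.
case: b2 b2n0 {sub tC} E1 E2 => // b b2 _; move: (b :: b2) => {b}b2 E1 E2 wC wC' wv wv'.
exists p, w, q, p', w', q'; split=> //; split=> //; split=> //.
- rewrite val_omega_pump; first by rewrite /= /om_mul pv qv wv fm_mulA.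
  by move: E1; rewrite /= /om_mul pv wv.
- rewrite val_omega_pump; first by rewrite /= /om_mul pv' qv' wv' fm_mulA.
  by move: E2; rewrite /= /om_mul pv' wv'.
Qed.

(** * Peeling off factors of full content *)

Section Peel.
Variables (C : {set A}) (n0 n : nat).
Hypothesis le_n0n : n0 <= n.
Hypothesis twin_proper : forall x y, content x \proper C -> sim n0 x y -> twin (content x) x y.

Lemma twin_of_sim_nil k y : sim k.+1 [::] y -> twin (content [::]) [::] y.
Proof.
move=> /simS_mem yE; rewrite (_ : y = [::]).
  by rewrite (_ : content _ = set0); [apply: twin_nil | apply/setP => a; rewrite !inE].
by case: y yE => // a y /(_ a); rewrite mem_head.
Qed.

Lemma content_proper a x : a \notin x -> content x \proper a |: content x.
Proof. by move=> ax; rewrite properUr // sub1set inE. Qed.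

(** Each step costs one level of [sim] and cuts just after the first occurrence of the letter [a]
    that comes last: the part before it lacks [a], so it falls under [twin_proper], and with [a] its
    content is [C]. If the remainder loses a letter, the whole word is settled. *)
Lemma peel_left m x y : content x \subset C -> sim (m + n) x y ->
  twin (content x) x y \/
  exists bs x' y', [/\ size bs = m, forall b, b \in bs -> twin C b.1 b.2,
    x = flatten (unzip1 bs) ++ x', y = flatten (unzip2 bs) ++ y' & sim n x' y'].
Proof.
elim: m x y => [|m IH] x y xC xy; first by right; exists [::], x, y.
have [xpC|] := boolP (content x \proper C).
  by left; apply: twin_proper (sim_le _ xy); rewrite // (leq_trans le_n0n) ?leq_addl.
rewrite properEneq xC andbT negbK => /eqP cxC.
have [x0|/last_new_letter [a [x0 [x1 [xE ax0 cx]]]]] := eqVneq x [::].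
  by left; move: xy; rewrite x0; apply: twin_of_sim_nil.
rewrite xE in xy; have [y0 [y1 [yE ay0 xy0 xy1]]] := simS_first xy ax0.
have tw : twin C (x0 ++ [:: a]) (y0 ++ [:: a]).
  rewrite -cxC cx setUC; apply: twin_cat (twin_letter a).
  apply: twin_proper; first by rewrite -cxC cx content_proper.
  by apply: sim_le xy0; rewrite (leq_trans le_n0n) ?leq_addl.
have x1C : content x1 \subset C.
  by rewrite -cxC xE content_cat content_cons setUCA subsetU // subsetUr orbT.
have [tw1|[bs [x' [y' [sz tbs x1E y1E xy']]]]] := IH _ _ x1C xy1.
  left; rewrite cxC xE yE -(cat1s a x1) -(cat1s a y1) !catA -(setUidPl x1C).
  exact: twin_cat.
right; exists ((x0 ++ [:: a], y0 ++ [:: a]) :: bs), x', y'; split=> //=.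
- by rewrite sz.
- by move=> b; rewrite inE => /predU1P [->|/tbs].
- by rewrite -!catA -x1E -xE.
- by rewrite -!catA -y1E.
Qed.

Lemma peel_right m x y : content x \subset C -> sim (m + n) x y ->
  twin (content x) x y \/
  exists bs x' y', [/\ size bs = m, forall b, b \in bs -> twin C b.1 b.2,
    x = x' ++ flatten (unzip1 bs), y = y' ++ flatten (unzip2 bs) & sim n x' y'].
Proof.
elim: m x y => [|m IH] x y xC xy; first by right; exists [::], x, y; rewrite /= !cats0.
have [xpC|] := boolP (content x \proper C).
  by left; apply: twin_proper (sim_le _ xy); rewrite // (leq_trans le_n0n) ?leq_addl.
rewrite properEneq xC andbT negbK => /eqP cxC.
have [x0|/first_unrepeated_letter [a [x0 [x1 [xE ax1 cx]]]]] := eqVneq x [::].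
  by left; move: xy; rewrite x0; apply: twin_of_sim_nil.
rewrite xE in xy; have [y0 [y1 [yE ay1 xy0 xy1]]] := simS_last xy ax1.
have tw : twin C (a :: x1) (a :: y1).
  rewrite -cxC cx; apply: (twin_cat (twin_letter a)).
  apply: twin_proper; first by rewrite -cxC cx content_proper.
  by apply: sim_le xy1; rewrite (leq_trans le_n0n) ?leq_addl.
have x0C : content x0 \subset C by rewrite -cxC xE content_cat subsetUl.
have [tw0|[bs [x' [y' [sz tbs x0E y0E xy']]]]] := IH _ _ x0C xy0.
  by left; rewrite cxC xE yE -(setUidPr x0C); apply: twin_cat.
(* The new block stands to the right of the remainder's blocks, hence [rcons]. *)
right; exists (rcons bs (a :: x1, a :: y1)), x', y'.
rewrite size_rcons sz /unzip1 /unzip2 !map_rcons !flatten_rcons !catA -x0E -y0E; split=> //.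
by move=> b; rewrite mem_rcons inE => /predU1P [->|/tbs].
Qed.

End Peel.

Lemma twin_of_sim k : exists n, forall x y, #|content x| <= k -> sim n x y ->
  twin (content x) x y.
Proof.
elim: k => [|k [n0 IH]].
  (* Level 1 already detects letters, so the word equivalent to the empty one is empty. *)
  exists 1 => x y; rewrite leqn0 cards_eq0 => /eqP /content0 ->; exact: twin_of_sim_nil.
(* Each peeling takes [m] levels, enough blocks for the pigeonhole in pairs of values; [n0] serves
   the smaller contents, and one more level keeps the letters of the middle words equal. *)
set m := (#|T| * #|T|).+1; exists (m + (m + n0.+1)) => x y xk xy.
set C := content x.
have proper_twin x' y' : content x' \proper C -> sim n0 x' y' -> twin (content x') x' y'.
  by move=> /proper_card x'C; apply: IH; rewrite -ltnS (leq_trans x'C).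
have twin_blocks bs : size bs = m -> (forall b, b \in bs -> twin C b.1 b.2) ->
    twin C (flatten (unzip1 bs)) (flatten (unzip2 bs)).
  by case: bs => // b bs _; apply: twin_flatten.
have le_n0 : n0 <= m + n0.+1 by rewrite (leq_trans (leqnSn _)) ?leq_addl.
have [//|[bs [x1 [y1 [sz tbs xE yE xy1]]]]] := peel_left le_n0 proper_twin (subxx C) xy.
have x1C : content x1 \subset C by rewrite /C xE content_cat subsetUr.
have [tw|[bs2 [x2 [y2 [sz2 tbs2 x1E y1E xy2]]]]] :=
    peel_right (leqnSn n0) proper_twin x1C xy1.
  by rewrite xE yE -(setUidPl x1C); apply: twin_cat (twin_blocks bs sz tbs) tw.
have x2C : {subset x2 <= C}.
  by move=> a ax2; rewrite inE xE x1E !mem_cat ax2 orbT.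
have y2C : {subset y2 <= C} by move=> a; rewrite -(simS_mem xy2); apply: x2C.
have [|p [w [q [p' [w' [q' [[pE wE qE] [[pC pC' qC qC'] [wC wC' v1 v1']]]]]]]]] :=
  twin_pump _ tbs; first by rewrite sz.
have [|s [v [r [s' [v' [r' [[sE vE rE] [[sC sC' rC rC'] [vC vC' v2 v2']]]]]]]]] :=
  twin_pump _ tbs2; first by rewrite sz2.
(* The middle words [x2] and [y2] may differ provably: they are absorbed between the two omega
   powers. *)
exists (p ** Oomega w ** q ** Oword x2 ** (s ** Oomega v ** r)).
exists (p' ** Oomega w' ** q' ** Oword y2 ** (s' ** Oomega v' ** r')).
have valM (g h : Omega A) : val_of (g ** h) = fm_mul (val_of g) (val_of h) by [].
have spansP (p0 w0 q0 g s0 v0 r0 : Omega A) : within C p0 -> spans S C w0 -> within C q0 ->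
    within C g -> within C s0 -> spans S C v0 -> within C r0 ->
    spans S C (p0 ** Oomega w0 ** q0 ** g ** (s0 ** Oomega v0 ** r0)).
  move=> p0C [w0C w0a] q0C gC s0C [v0C _] r0C; split=> [|a aC].
    by do !(apply: within_mul => //); apply: within_omega.
  by do 3!apply: has_letter_mull => //; apply/has_letter_mulr/has_letter_omega/w0a.
have absorb (p0 w0 q0 g s0 v0 r0 : Omega A) : spans S C w0 -> within C q0 ->
    within C g -> within C s0 -> spans S C v0 ->
    p0 ** Oomega w0 ** q0 ** g ** (s0 ** Oomega v0 ** r0) ===
    p0 ** Oomega w0 ** Oomega v0 ** r0.
  move=> w0C q0C gC s0C v0C; rewrite -(OmulA p0 (Oomega w0) (Oomega v0)).
  rewrite -(Oprov_omega_absorb S_DA w0C v0C (within_mul (within_mul q0C gC) s0C)).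
  by rewrite !OmulA.
split.
- rewrite !absorb //; try exact: within_word.
  by rewrite pE wE vE rE.
- by apply: spansP => //; apply: within_word.
- by apply: spansP => //; apply: within_word.
- rewrite xE x1E !Oword_cat (valM (p ** _ ** q ** _)) (valM (p ** _ ** q)) v1 v2.
  by rewrite !valM fm_mulA.
- rewrite yE y1E !Oword_cat (valM (p' ** _ ** q' ** _)) (valM (p' ** _ ** q')) v1' v2'.
  by rewrite !valM fm_mulA.
Qed.

End Twins.

(** * From twins to h-strength *)

Lemma h_strong_of_proves_DA S :
  proves_DA S -> (forall A n, models S (simM A n)) -> h_strong S.
Proof.
move=> S_DA simS_S B u v uO vO uv; apply: prov_closure => // T e.
(* The level is fixed before the words are chosen, since it serves all words over [B]; validity of
   the identity in [simM B n] then makes the words equivalent. *)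
have [n twinP] := twin_of_sim e S_DA #|B|.
have [x [xT xn]] := joint_word e n (exist _ u uO).
have [y [yT yn]] := joint_word e n (exist _ v vO).
have xy : sim n x y.
  by have := uv _ (simS_S B n) (fun a => sim_img n [:: a]); move: xn yn => /= -> -> [].
have [|s [r [sr _ _ sE rE]]] := twinP x y _ xy; first exact: max_card.
by exists (sval s), (sval r); rewrite sE rE -xT -yT.
Qed.

Theorem theorem7p6 : h_strong SigmaSet /\ h_strong GammaSet.
Proof.
split; apply: h_strong_of_proves_DA.
- exact: proves_DA_SigmaSet.
- exact: simM_SigmaSet.
- exact: proves_DA_GammaSet.
- exact: simM_GammaSet.
Qed.
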